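(* Let $\Gamma = (V, E)$ be a finite $d$-regular graph with $d \ge 1$, and let $C$ be a total perfect code in $\Gamma$. Then for every equitable partition $\pi = \{V_1, \ldots, V_m\}$ of $\Gamma$ there exists a vector $(k_1, \ldots, k_m)^T \in \mathbb{Q}^m$ such that $$|V_i \cap C| = \left(\frac{1}{d} + k_i\right)|V_i|, \quad i = 1, \ldots, m,$$ and $$A_\pi (k_1, \ldots, k_m)^T = (0, \ldots, 0)^T.$$
   Context: A total perfect code in $\Gamma$ is a set $C \subseteq V$ such that every vertex of $\Gamma$ is adjacent to exactly one vertex of $C$. An equitable partition of $\Gamma$ is a partition $\pi = \{V_1, \ldots, V_m\}$ of $V$ such that for all $i, j$ the number $b_{ij}$ of neighbours in $V_j$ of a vertex $u \in V_i$ does not depend on the choice of $u \in V_i$. Its quotient matrix is $A_\pi = (b_{ij})_{1 \le i, j \le m}$. *)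

(* Defs.v *)
From mathcomp Require Import all_boot all_order all_algebra.

Set Implicit Arguments.
Unset Strict Implicit.
Unset Printing Implicit Defensive.

Import GRing.Theory.
Local Open Scope ring_scope.

(* A finite simple undirected graph is its adjacency relation on a finType. *)
Definition simple_graph (T : finType) (e : rel T) : Prop :=
  symmetric e /\ irreflexive e.

Definition nbrs_in (T : finType) (e : rel T) (A : {set T}) (u : T) : {set T} :=
  [set v in A | e u v].

Definition regular_graph (T : finType) (e : rel T) (d : nat) : Prop :=
  forall u : T, #|nbrs_in e [set: T] u| = d.

Definition total_perfect_code (T : finType) (e : rel T) (C : {set T}) : Prop :=
  forall u : T, #|nbrs_in e C u| = 1%N.

(* Injectivity makes the enumeration V_1, ..., V_m list every block once;
   [partition] already forces the blocks to be nonempty. *)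
Definition indexed_partition (T : finType) (m : nat) (V : 'I_m -> {set T}) :
    Prop :=
  injective V /\ partition [set V i | i : 'I_m] [set: T].

Definition equitable_partition (T : finType) (e : rel T) (m : nat)
    (V : 'I_m -> {set T}) : Prop :=
  indexed_partition V /\
  forall (i j : 'I_m) (u v : T), u \in V i -> v \in V i ->
    #|nbrs_in e (V j) u| = #|nbrs_in e (V j) v|.

(* The entry b_ij is read off an arbitrary vertex of V_i; see quotient_mxE. The
   value 0 is a dummy, used only for an empty V_i. *)
Definition quotient_mx (T : finType) (e : rel T) (m : nat)
    (V : 'I_m -> {set T}) : 'M[rat]_m :=
  \matrix_(i, j)
    if [pick u in V i] is Some u then #|nbrs_in e (V j) u|%:R else 0.

Lemma quotient_mxE (T : finType) (e : rel T) (m : nat) (V : 'I_m -> {set T})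
    (i j : 'I_m) (u : T) :
  equitable_partition e V -> u \in V i ->
  quotient_mx e V i j = #|nbrs_in e (V j) u|%:R.
Proof.
move=> [_ eqV] uVi; rewrite mxE; case: pickP => [v vVi|/(_ u)].
  by rewrite (eqV i j v u).
by rewrite uVi.
Qed.

(* Main.v *)
(** Put [k_i = |V_i :&: C| / |V_i| - 1 / d].  The rows of the quotient matrix
    sum to [d], so [A_pi k = 0] amounts to [\sum_j b_ij |V_j :&: C| / |V_j| = 1].
    Counting the edges between [V_i] and [V_j] from both sides gives
    [b_ij / |V_j| = b_ji / |V_i|], and [\sum_j b_ji |V_j :&: C|] counts the edges
    between [C] and [V_i]; there are [|V_i|] of them, because each vertex has
    exactly one neighbour in [C]. *)
Require Import Defs.
From mathcomp Require Import all_boot all_order all_algebra.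

Set Implicit Arguments.
Unset Strict Implicit.
Unset Printing Implicit Defensive.

Import GRing.Theory.
Local Open Scope ring_scope.

Lemma card_nbrs_in (T : finType) (e : rel T) (A : {set T}) (u : T) :
  #|nbrs_in e A u| = (\sum_(v in A) e u v)%N.
Proof.
rewrite -sum1_card big_mkcond [RHS]big_mkcond /=.
by apply: eq_bigr => v _; rewrite inE; case: (v \in A); case: (e u v).
Qed.

(** Both sides count the adjacent pairs in [A] x [B]; symmetry of [e] lets each pair be read from
    either end. *)
Lemma double_count_nbrs (T : finType) (e : rel T) (A B : {set T}) :
  symmetric e ->
  (\sum_(u in A) #|nbrs_in e B u| = \sum_(v in B) #|nbrs_in e A v|)%N.
Proof.
move=> esym; under eq_bigr do rewrite card_nbrs_in.
rewrite exchange_big; apply: eq_bigr => v _.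
by rewrite card_nbrs_in; apply: eq_bigr => u _; rewrite esym.
Qed.

Section IndexedPartition.

Variables (T : finType) (m : nat) (V : 'I_m -> {set T}).
Hypothesis partV : Defs.indexed_partition V.

Lemma card_block_gt0 (i : 'I_m) : (0 < #|V i|)%N.
Proof.
have [_ /and3P[_ _ V0]] := partV; rewrite card_gt0.
by apply: contraNneq V0 => <-; rewrite imset_f.
Qed.

Lemma sum_blocks (F : T -> nat) :
  (\sum_j \sum_(v in V j) F v = \sum_v F v)%N.
Proof.
have [injV /and3P[/eqP covV trivV _]] := partV.
transitivity (\sum_(v in cover [set V i | i : 'I_m]) F v)%N.
  (* Injectivity of [V] turns the sum over the set of blocks into a sum over indices. *)
  by rewrite big_trivIset //= big_imset //= => i j _ _ /injV.
by apply: eq_bigl => v; rewrite covV inE.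
Qed.

End IndexedPartition.

Section EquitablePartition.

Variables (T : finType) (e : rel T) (m : nat) (V : 'I_m -> {set T}).
Hypotheses (esym : symmetric e) (eqV : equitable_partition e V).

(** The block [V i] is nonempty, so its row is read off an actual vertex, whose [d] neighbours are
    split among the blocks. *)
Lemma sum_quotient_row (d : nat) (i : 'I_m) :
  regular_graph e d -> \sum_j quotient_mx e V i j = d%:R.
Proof.
move=> reg; have /card_gt0P[u uVi] := card_block_gt0 eqV.1 i.
under eq_bigr do rewrite (quotient_mxE _ eqV uVi) card_nbrs_in.
rewrite -natr_sum (sum_blocks eqV.1) -(reg u) card_nbrs_in.
by congr _%:R; apply: eq_bigl => v; rewrite inE.
Qed.

(** Stated for subsets of a block so as to serve both whole blocks and their intersections with the
    code. *)
Lemma sum_card_nbrs_quotient (i j : 'I_m) (A : {set T}) : A \subset V i ->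
  (\sum_(u in A) #|nbrs_in e (V j) u|)%N%:R = quotient_mx e V i j * #|A|%:R.
Proof.
move=> /subsetP sAV; rewrite natr_sum mulr_natr -sumr_const; apply: eq_bigr => u uA.
by rewrite (quotient_mxE _ eqV (sAV u uA)).
Qed.

Lemma quotient_mx_balance (i j : 'I_m) :
  quotient_mx e V i j * #|V i|%:R = quotient_mx e V j i * #|V j|%:R.
Proof. by rewrite -!sum_card_nbrs_quotient // double_count_nbrs. Qed.

Lemma sum_quotient_col_code (C : {set T}) (i : 'I_m) :
  total_perfect_code e C ->
  \sum_j quotient_mx e V j i * #|V j :&: C|%:R = #|V i|%:R.
Proof.
move=> codeC.
under eq_bigr => j _.
  rewrite -(sum_card_nbrs_quotient _ (subsetIl _ _)).
  under eq_bigl do rewrite inE.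
  (* Membership in [C] moves into the summand, so that the sums over the blocks merge into one over
     all vertices. *)
  rewrite big_mkcondr; over.
rewrite -natr_sum (sum_blocks eqV.1) -big_mkcond double_count_nbrs //.
by under eq_bigr do rewrite codeC; rewrite sum1_card.
Qed.

End EquitablePartition.

Theorem theorem5p3 (T : finType) (e : rel T) (d : nat) (C : {set T})
    (he : simple_graph e) (hd : (1 <= d)%N) (hreg : regular_graph e d)
    (hC : total_perfect_code e C)
    (m : nat) (V : 'I_m -> {set T}) (hV : equitable_partition e V) :
  exists k : 'cV[rat]_m,
    (forall i : 'I_m,
       #|V i :&: C|%:R = (1 / d%:R + k i ord0) * #|V i|%:R :> rat) /\
    quotient_mx e V *m k = 0.
Proof.
have [esym _] := he.
have cardV0 i : #|V i|%:R != 0 :> rat.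
  by rewrite Num.Theory.pnatr_eq0 -lt0n (card_block_gt0 hV.1).
have d0 : d%:R != 0 :> rat by rewrite Num.Theory.pnatr_eq0 -lt0n.
exists (\col_i (#|V i :&: C|%:R / #|V i|%:R - 1 / d%:R)); split=> [i|].
  by rewrite mxE addrC subrK divfK.
apply/colP => i; rewrite !mxE; under eq_bigr do rewrite [X in _ * X]mxE mulrBr.
rewrite sumrB -mulr_suml (sum_quotient_row hV i hreg) mul1r divff //.
apply/eqP; rewrite subr_eq0; apply/eqP.
(* Scaling by [|V_i|] produces [b_ij |V_i| = b_ji |V_j|], whose factor [|V_j|] cancels the
   denominator of the [j]-th term. *)
apply: (mulIf (cardV0 i)); rewrite mul1r.
rewrite -[RHS](sum_quotient_col_code esym hV i hC) mulr_suml; apply: eq_bigr => j _.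
by rewrite mulrAC quotient_mx_balance // mulrACA divff // mulr1.
Qed.
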